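(* (i) Both $\mathbf{PT}^+$ and $\mathbf{FPT}$ characterize the set of all team properties (every team property is definable); in particular $\mathbf{PT}^+\equiv\mathbf{FPT}$ (same expressive power). (ii) $\mathbf{PT}$ characterizes the set of all team properties which contain the empty team. (iii) $\mathbf{PU}$ characterizes the set of all union closed team properties which contain the empty team. (iv) $\mathbf{PU}^+$ characterizes the set of all union closed team properties. (v) $\mathbf{PD}$ characterizes the set of all downward closed team properties which contain the empty team. (vi) $\mathbf{PD}^+$ characterizes the set of all downward closed team properties.
   Context: Valuations are functions $s:N\to\{0,1\}$ on a set $N$ of indices; a team on $N$ is a set of valuations; a team property is a set of teams. Atoms and semantics: $X\models p_i$ iff $s(i)=1$ for all $s\in X$; $X\models\neg p_i$ iff $s(i)=0$ for all $s\in X$; $X\models\bot$ iff $X=\emptyset$; $X\models\mathrm{NE}$ iff $X\neq\emptyset$; dependence atom $=\!(p_{i_1}\dots p_{i_k},p_j)$: any $s,s'\in X$ agreeing on $i_1,\dots,i_k$ agree on $j$; independence atom $p_{i_1}\dots p_{i_k}\perp p_{j_1}\dots p_{j_m}$: for all $s,s'\in X$ there is $s''\in X$ agreeing with $s$ on the $i$'s and with $s'$ on the $j$'s; inclusion atom $p_{i_1}\dots p_{i_k}\subseteq p_{j_1}\dots p_{j_k}$: for all $s\in X$ there is $s'\in X$ with $(s(i_1),\dots,s(i_k))=(s'(j_1),\dots,s'(j_k))$. Connectives: $X\models\phi\wedge\psi$ iff both; tensor $X\models\phi\otimes\psi$ iff $X=Y\cup Z$ with $Y\models\phi$, $Z\models\psi$;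 nonempty disjunction (written $\circledast$ here) $X\models\phi\circledast\psi$ iff $X=\emptyset$ or $X=Y\cup Z$ with $Y,Z$ nonempty, $Y\models\phi$, $Z\models\psi$; Boolean disjunction $X\models\phi\vee\psi$ iff $X\models\phi$ or $X\models\psi$; linear implication $X\models\phi\multimap\psi$ iff for every team $Y$ with $Y\models\phi$, $X\cup Y\models\psi$. Logics (by atoms; connectives): $\mathbf{PT}$: $p_i,\neg p_i,\bot$; $\wedge,\circledast,\vee$. $\mathbf{PT}^+$: $p_i,\neg p_i,\bot,\mathrm{NE}$; $\wedge,\otimes,\vee$. $\mathbf{PU}$: $p_i,\neg p_i,\bot$; $\wedge,\otimes,\circledast$. $\mathbf{PU}^+$: $p_i,\neg p_i,\bot,\mathrm{NE}$; $\wedge,\otimes,\circledast$. $\mathbf{PD}$: $p_i,\neg p_i,\bot$, dependence atoms; $\wedge,\otimes,\vee$. $\mathbf{PD}^+$: same atoms; $\wedge,\otimes,\vee,\multimap$. $\mathbf{FPT}$: $p_i,\neg p_i,\bot,\mathrm{NE}$, independence, dependence and inclusion atoms; $\wedge,\otimes,\circledast,\vee$. For a set $\mathbb{P}$ of team properties let $\mathbb{P}_N=\{\mathsf{P}\upharpoonright N:\mathsf{P}\in\mathbb{P}\}$, $\mathsf{P}\upharpoonright N=\{X\upharpoonright N:X\in\mathsf{P}\}$. A logic characterizes $\mathbb{P}$ if for each finite $N=\{i_1,\dots,i_n\}$, $\mathbb{P}_N=\{\{X\subseteq 2^N: X\models\phi\}:\phi(p_{i_1},\dots,p_{i_n})\text{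 a formula of the logic}\}$. A team property $\mathsf{P}$ is downward closed if $Y\subseteq X\in\mathsf{P}$ implies $Y\in\mathsf{P}$, and union closed if $\mathcal{X}\subseteq\mathsf{P}$ implies $\bigcup\mathcal{X}\in\mathsf{P}$. Two logics have the same expressive power if every formula of each is semantically equivalent to a formula of the other.
   Formalization: ''Union closed'' is taken over nonempty families only (with the empty family, (iv) fails for NE), and ''characterizes'' ranges over nonempty finite N (for N empty there are no variables and (ii), (iii), (v), (vi) fail). *)

(* Defs.v *)
From mathcomp Require Import all_boot finmap.
From mathcomp Require Import boolp classical_sets.

Set Implicit Arguments.
Unset Strict Implicit.
Unset Printing Implicit Defensive.

Local Open Scope fset_scope.
Local Open Scope classical_set_scope.

Definition valuation (V : Type) := V -> bool.
Definition team (V : Type) := set (valuation V).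
Definition team_property (V : Type) := set (team V).

(* A formula of [formula V] has its propositional variables among the p_i with
   i : V, and is evaluated on teams on V.  Taking V := N for a finite set N of
   indices gives the formulas phi(p_{i_1},...,p_{i_n}). *)
Inductive formula (V : Type) : Type :=
| Var of V
| NegVar of V
| Bot
| NE
| Dep of seq V & V
| Indep of seq V & seq V
| Incl (k : nat) of k.-tuple V & k.-tuple V
| And of formula V & formula V
| Tensor of formula V & formula V
| NeDisj of formula V & formula V
| BoolDisj of formula V & formula V
| LinImp of formula V & formula V.

Arguments Bot {V}.
Arguments NE {V}.

Fixpoint sat (V : Type) (X : team V) (f : formula V) : Prop :=
  match f with
  | Var i => forall s, X s -> s i = true
  | NegVar i => forall s, X s -> s i = false
  | Bot => X = set0
  | NE => X <> set0
  | Dep us j =>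
      forall s s', X s -> X s' -> map s us = map s' us -> s j = s' j
  | Indep us vs =>
      forall s s', X s -> X s' ->
        exists s'', [/\ X s'', map s'' us = map s us & map s'' vs = map s' vs]
  | Incl _ us vs =>
      forall s, X s -> exists s', X s' /\ map s us = map s' vs
  | And f g => sat X f /\ sat X g
  | Tensor f g => exists Y Z, [/\ X = Y `|` Z, sat Y f & sat Z g]
  | NeDisj f g =>
      X = set0 \/
      exists Y Z, [/\ X = Y `|` Z, Y <> set0, Z <> set0, sat Y f & sat Z g]
  | BoolDisj f g => sat X f \/ sat X g
  | LinImp f g => forall Y : team V, sat Y f -> sat (X `|` Y) g
  end.

(* A logic is given by the atoms and connectives it allows. *)
Inductive symbol : Type :=
| sVar | sNegVar | sBot | sNE | sDep | sIndep | sIncl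
| sAnd | sTensor | sNeDisj | sBoolDisj | sLinImp.

Definition logic := set symbol.

Fixpoint in_logic (V : Type) (L : logic) (f : formula V) : Prop :=
  match f with
  | Var _ => L sVar
  | NegVar _ => L sNegVar
  | Bot => L sBot
  | NE => L sNE
  | Dep _ _ => L sDep
  | Indep _ _ => L sIndep
  | Incl _ _ _ => L sIncl
  | And f g => [/\ L sAnd, in_logic L f & in_logic L g]
  | Tensor f g => [/\ L sTensor, in_logic L f & in_logic L g]
  | NeDisj f g => [/\ L sNeDisj, in_logic L f & in_logic L g]
  | BoolDisj f g => [/\ L sBoolDisj, in_logic L f & in_logic L g]
  | LinImp f g => [/\ L sLinImp, in_logic L f & in_logic L g]
  end.

Definition PT : logic :=
  [set sVar; sNegVar; sBot; sAnd; sNeDisj; sBoolDisj].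
Definition PTplus : logic :=
  [set sVar; sNegVar; sBot; sNE; sAnd; sTensor; sBoolDisj].
Definition PU : logic :=
  [set sVar; sNegVar; sBot; sAnd; sTensor; sNeDisj].
Definition PUplus : logic :=
  [set sVar; sNegVar; sBot; sNE; sAnd; sTensor; sNeDisj].
Definition PD : logic :=
  [set sVar; sNegVar; sBot; sDep; sAnd; sTensor; sBoolDisj].
Definition PDplus : logic :=
  [set sVar; sNegVar; sBot; sDep; sAnd; sTensor; sBoolDisj; sLinImp].
Definition FPT : logic :=
  [set sVar; sNegVar; sBot; sNE; sIndep; sDep; sIncl;
       sAnd; sTensor; sNeDisj; sBoolDisj].

Definition val_restr (I : choiceType) (N : {fset I}) (s : valuation I) :
  valuation N := fun i => s (fsval i).
Arguments val_restr {I} N s.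
Definition team_restr (I : choiceType) (N : {fset I}) (X : team I) : team N :=
  [set val_restr N s | s in X].
Arguments team_restr {I} N X.
Definition prop_restr (I : choiceType) (N : {fset I}) (P : team_property I) :
  team_property N := [set team_restr N X | X in P].
Arguments prop_restr {I} N P.

Definition defined_by (V : Type) (f : formula V) : team_property V :=
  [set X | sat X f].

(* N is nonempty: over the empty set there is no variable, and for instance the
   property "all teams" would not be definable in PT, PU, PD, PD+. *)
Definition characterizes (I : choiceType) (L : logic)
    (PP : set (team_property I)) : Prop :=
  forall N : {fset I}, N <> fset0 ->
    [set prop_restr N P | P in PP] =
    [set defined_by f | f in [set f : formula N | in_logic L f]].

Definition equivalent (V : Type) (f g : formula V) : Prop :=
  forall X : team V, sat X f <-> sat X g.

Definition same_expressive_power (I : Type) (L1 L2 : logic) : Prop :=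
  (forall f : formula I, in_logic L1 f ->
     exists g : formula I, in_logic L2 g /\ equivalent f g) /\
  (forall g : formula I, in_logic L2 g ->
     exists f : formula I, in_logic L1 f /\ equivalent g f).

Definition contains_empty (V : Type) (P : team_property V) : Prop := P set0.

Definition downward_closed (V : Type) (P : team_property V) : Prop :=
  forall X Y : team V, Y `<=` X -> P X -> P Y.

(* Only nonempty families: with the empty family, every union closed property
   would contain the empty team, and NE would not define such a property. *)
Definition union_closed (V : Type) (P : team_property V) : Prop :=
  forall F : set (team V), F `<=` P -> F !=set0 -> P (\bigcup_(X in F) X).

(* Main.v *)
(** Over finitely many indices there are finitely many valuations and teams, so
    a property can be defined by combining formulas for its members.  The
    subteams of [{s}] are defined by the conjunction of the literals true at
    [s].  From these the disjunctions of each logic build, for a team [X], the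
    property [{X}] (PT+), [{set0, X}] (PT, PU) or the set of subteams of [X]
    (PD).  A Boolean disjunction over the members of a property then defines it
    (PT+, PT, PD), while a tensor defines its closure under unions (PU).  PU+
    removes the empty team with [NE], and PD+ defines the empty property by
    [p -o Bot].

    Renaming the variables of a formula along an injection pulls the property it
    defines back along the reindexing of teams; this transfers definability
    between the whole index set and its finite subsets. *)
Require Import Defs.
From mathcomp Require Import all_boot finmap.
From mathcomp Require Import boolp classical_sets cardinality.

Set Implicit Arguments.
Unset Strict Implicit.
Unset Printing Implicit Defensive.

Local Open Scope classical_set_scope.

Lemma finite_set_ind (T : Type) (K : set T -> Prop) :
  K set0 -> (forall x A, K A -> K (x |` A)) ->
  forall A, finite_set A -> K A.
Proof.
elim/Pchoice: T => T in K *; move=> K0 KU A /finite_fsetP[X ->].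
elim/fset1U_rect: X => [|x X _ KX]; first by rewrite set_fset0.
by rewrite set_fsetU1; apply: KU.
Qed.

Lemma setU1K (T : Type) (x : T) (A : set T) : ~ A x -> (x |` A) `\ x = A.
Proof. by move=> nAx; rewrite setDUl setDv set0U not_setD1. Qed.

Lemma image_setI_preimage (T U : Type) (f : T -> U) (A : set T) (B : set U) :
  f @` (A `&` f @^-1` B) = f @` A `&` B.
Proof.
apply/seteqP; split=> [_ [x [Ax Bfx] <-]|_ [[x Ax <-] Bfx]].
  by split=> //; exists x.
by exists x.
Qed.

Lemma set1_neq0 (T : Type) (x : T) : [set x] <> set0.
Proof. by apply/eqP/set0P; exists x. Qed.

Definition subsets (T : Type) (A : set T) : set (set T) := [set B | B `<=` A].

Lemma subsets0 (T : Type) : subsets (set0 : set T) = [set set0].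
Proof. by apply/seteqP; split=> B; rewrite /subsets /= subset0. Qed.

Lemma subsets1 (T : Type) (x : T) : subsets [set x] = [set set0; [set x]].
Proof. by apply/seteqP; split=> [B /subset_set1|B [] ->]. Qed.

Lemma finite_subsets (T : Type) (A : set T) :
  finite_set A -> finite_set (subsets A).
Proof.
elim/finite_set_ind => [|x {}A finA]; first by rewrite subsets0.
have finU : finite_set (subsets A `|` setU [set x] @` subsets A).
  by rewrite finite_setU; split=> //; apply: finite_image.
apply: sub_finite_set finU => B BxA.
have BA : B `\ x `<=` A by move=> y [/BxA[]].
have [Bx|nBx] := pselect (B x); [right|left].
  by exists (B `\ x); rewrite ?setD1K.
by move=> y By; apply: BA; split=> // yx; apply: nBx; rewrite -yx.
Qed.

Lemma finite_valuations (V : finType) : finite_set [set: valuation V].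
Proof.
have := finite_image (fun f : {ffun V -> bool} => f : valuation V)
  (@finite_finset _ setT).
apply: sub_finite_set => s _.
by exists [ffun i => s i] => //; apply/funext => i; rewrite ffunE.
Qed.

Lemma finite_team (V : finType) (X : team V) : finite_set X.
Proof. exact: sub_finite_set (finite_valuations V). Qed.

Lemma finite_team_property (V : finType) (P : team_property V) : finite_set P.
Proof.
by apply: sub_finite_set (finite_subsets (finite_valuations V)) => X _ s.
Qed.

Section Operations.
Variable V : Type.
Implicit Types (A B : team V) (P Q : team_property V).

Definition tensor P Q : team_property V :=
  [set X | exists Y Z, [/\ X = Y `|` Z, P Y & Q Z]].

Definition nedisj P Q : team_property V :=
  set0 |` tensor (P `\ set0) (Q `\ set0).

Definition linimp P Q : team_property V :=
  [set X | forall Y, P Y -> Q (X `|` Y)].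

Section DefinedBy.
Variables f g : formula V.

Lemma defined_by_And :
  defined_by (And f g) = defined_by f `&` defined_by g.
Proof. by []. Qed.

Lemma defined_by_Tensor :
  defined_by (Tensor f g) = tensor (defined_by f) (defined_by g).
Proof. by []. Qed.

Lemma defined_by_NeDisj :
  defined_by (NeDisj f g) = nedisj (defined_by f) (defined_by g).
Proof.
apply/seteqP; split=> X [X0|[Y [Z]]]; first by left.
- by case=> XYZ Y0 Z0 Yf Zg; right; exists Y, Z.
- by left.
- by case=> XYZ [Yf Y0] [Zg Z0]; right; exists Y, Z.
Qed.

Lemma defined_by_BoolDisj :
  defined_by (BoolDisj f g) = defined_by f `|` defined_by g.
Proof. by []. Qed.

Lemma defined_by_LinImp :
  defined_by (LinImp f g) = linimp (defined_by f) (defined_by g).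
Proof. by []. Qed.

End DefinedBy.

Lemma tensor_set1 A B : tensor [set A] [set B] = [set A `|` B].
Proof.
apply/seteqP; split=> X; first by move=> [Y [Z [-> -> ->]]].
by move=> ->; exists A, B.
Qed.

Lemma nedisj_set0_or1 A B : A <> set0 -> B <> set0 ->
  nedisj [set set0; A] [set set0; B] = [set set0; A `|` B].
Proof.
by move=> A0 B0; rewrite /nedisj !setU1K ?tensor_set1// => e;
  [apply: B0|apply: A0].
Qed.

Lemma tensor_subsets A B : tensor (subsets A) (subsets B) = subsets (A `|` B).
Proof.
apply/seteqP; split=> X; first by move=> [Y [Z [-> YA ZB]]]; apply: setUSS.
move=> XAB; exists (X `&` A), (X `&` B).
by split; [rewrite -setIUr setIidl|exact: subIsetr|exact: subIsetr].
Qed.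

Definition union_closure P : team_property V :=
  [set \bigcup_(X in F) X | F in subsets P].

Lemma union_closure0 : union_closure set0 = [set set0].
Proof. by rewrite /union_closure subsets0 image_set1 bigcup_set0. Qed.

Lemma union_closure1 A : union_closure [set A] = [set set0; A].
Proof.
rewrite /union_closure subsets1 image_setU !image_set1.
by rewrite bigcup_set0 bigcup_set1.
Qed.

Lemma union_closureU P Q :
  union_closure (P `|` Q) = tensor (union_closure P) (union_closure Q).
Proof.
apply/seteqP; split=> X.
  move=> [F FPQ <-]; rewrite -{1}(setIidl FPQ) setIUr bigcup_setU.
  exists (\bigcup_(Y in F `&` P) Y), (\bigcup_(Y in F `&` Q) Y).
  by split=> //; [exists (F `&` P)|exists (F `&` Q)] => // Y [].
move=> [_ [_ [-> [F FP <-] [G GQ <-]]]].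
by exists (F `|` G); [exact: setUSS|rewrite bigcup_setU].
Qed.

Lemma union_closure_id P :
  union_closed P -> contains_empty P -> union_closure P = P.
Proof.
move=> P_union P0; apply/seteqP; split=> X.
  move=> [F FP <-].
  rewrite -(set0U (\bigcup_(_ in _) _)) -(bigcup_setU1 id set0 F).
  by apply: P_union; [move=> Y [->|/FP]|exists set0; left].
by move=> PX; exists [set X]; [move=> _ ->|rewrite bigcup_set1].
Qed.

End Operations.

Section UnionClosed.
Variable V : Type.
Implicit Types (P Q : team_property V).

Lemma union_closed_subsets (A : team V) : union_closed (subsets A).
Proof. by move=> F FA _; apply: bigcup_sub. Qed.

Lemma union_closed_set1 (A : team V) : union_closed [set A].
Proof.
by move=> F /subset_set1[->|->] [X //]; rewrite bigcup_set1.
Qed.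

Lemma union_closed_setI P Q :
  union_closed P -> union_closed Q -> union_closed (P `&` Q).
Proof.
move=> P_union Q_union F FPQ F0.
by split; [apply: P_union|apply: Q_union] => // X /FPQ[].
Qed.

Lemma union_closed_setD_set0 P : union_closed P -> union_closed (P `\ set0).
Proof.
move=> P_union F FP [X FX]; split.
  by apply: P_union; [move=> Y /FP[]|exists X].
move=> F0; have [_] := FP _ FX; apply.
by rewrite /set1 /= -subset0 -F0; apply: bigcup_sup.
Qed.

Lemma union_closed_setU_set0 P : union_closed P -> union_closed (set0 |` P).
Proof.
move=> P_union F FP _; have [FP0|/nonemptyPn FP0] := pselect (F `&` P !=set0).
  right; have -> : \bigcup_(X in F) X = \bigcup_(X in F `&` P) X.
    apply/seteqP; split; last by apply: bigcup_subset => X [].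
    move=> s [X FX Xs]; exists X => //; split=> //.
    by case: (FP _ FX) Xs => // ->.
  by apply: P_union => // X [].
left; apply: bigcup0 => X FX; have [//|PX] := FP _ FX.
by have : (F `&` P) X by []; rewrite FP0.
Qed.

Lemma union_closed_tensor P Q :
  union_closed P -> union_closed Q -> union_closed (tensor P Q).
Proof.
move=> P_union Q_union F FPQ [X FX]; have [Y [Z [XYZ PY QZ]]] := FPQ _ FX.
pose subteams := \bigcup_(X in F) subsets X.
have sub_parts X' Y' Z' : F X' -> X' = Y' `|` Z' -> subteams Y' /\ subteams Z'.
  by move=> FX' X'E; split; exists X' => // s; rewrite X'E; [left|right].
have [subY subZ] := sub_parts _ _ _ FX XYZ.
exists (\bigcup_(Y in subteams `&` P) Y), (\bigcup_(Z in subteams `&` Q) Z).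
split; [apply/seteqP; split=> s| |].
- move=> [X' FX' X's]; have [Y' [Z' [X'E PY' QZ']]] := FPQ _ FX'.
  have [subY' subZ'] := sub_parts _ _ _ FX' X'E.
  by move: X's; rewrite X'E => -[]; [left; exists Y'|right; exists Z'].
- by case=> -[Y' [[X' FX' YX'] _] Y's]; exists X' => //; apply: YX'.
- by apply: P_union; [move=> ? []|exists Y].
- by apply: Q_union; [move=> ? []|exists Z].
Qed.

Lemma union_closed_nedisj P Q :
  union_closed P -> union_closed Q -> union_closed (nedisj P Q).
Proof.
move=> P_union Q_union; apply: union_closed_setU_set0.
by apply: union_closed_tensor; apply: union_closed_setD_set0.
Qed.

Lemma union_closed_linimp P Q : union_closed Q -> union_closed (linimp P Q).
Proof.
move=> Q_union F FPQ [X0 FX0] Y PY.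
suff -> : \bigcup_(X in F) X `|` Y = \bigcup_(Z in setU^~ Y @` F) Z.
  by apply: Q_union; [move=> _ [X FX <-]; apply: FPQ|exists (X0 `|` Y), X0].
rewrite bigcup_image; apply/seteqP; split=> s.
  by move=> [[X FX Xs]|Ys]; [exists X => //; left|exists X0 => //; right].
by move=> [X FX [Xs|Ys]]; [left; exists X|right].
Qed.

Lemma union_closed_defined_by (L : logic) (f : formula V) :
  ~ L sDep -> ~ L sIndep -> ~ L sBoolDisj -> in_logic L f ->
  union_closed (defined_by f).
Proof.
move=> nDep nIndep nBoolDisj.
elim: f => [i|i|||us j|us vs|k us vs|f IHf g IHg|f IHf g IHg|f IHf g IHg
  |f _ g _|f _ g IHg] //= fL; try by case: fL.
- exact: (@union_closed_subsets [set s | s i = true]).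
- exact: (@union_closed_subsets [set s | s i = false]).
- exact: (@union_closed_set1 set0).
- by have := @union_closed_setD_set0 setT; rewrite setTD; apply.
- move=> F FP _ s [X FX Xs]; have [t [Xt st]] := FP X FX s Xs.
  by exists t; split=> //; exists X.
- by case: fL => _ /IHf fU /IHg gU; apply: (union_closed_setI fU gU).
- by case: fL => _ /IHf fU /IHg gU; apply: (union_closed_tensor fU gU).
- case: fL => _ /IHf fU /IHg gU; rewrite defined_by_NeDisj.
  exact: union_closed_nedisj.
- by case: fL => _ _ /IHg gU; apply: (union_closed_linimp gU).
Qed.
End UnionClosed.

Section DownwardClosed.
Variable V : Type.
Implicit Types (P Q : team_property V).

Lemma downward_closed_subsets (A : team V) : downward_closed (subsets A).
Proof. by move=> X Y YX XA; apply: subset_trans XA. Qed.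

Lemma downward_closed_setI P Q :
  downward_closed P -> downward_closed Q -> downward_closed (P `&` Q).
Proof. by move=> Pd Qd X Y YX [PX QX]; split; [apply: Pd PX|apply: Qd QX]. Qed.

Lemma downward_closed_setU P Q :
  downward_closed P -> downward_closed Q -> downward_closed (P `|` Q).
Proof.
by move=> Pd Qd X Y YX [PX|QX]; [left; apply: Pd PX|right; apply: Qd QX].
Qed.

Lemma downward_closed_tensor P Q :
  downward_closed P -> downward_closed Q -> downward_closed (tensor P Q).
Proof.
move=> Pd Qd X Y YX [A [B [XE PA QB]]]; exists (Y `&` A), (Y `&` B); split.
- by rewrite -setIUr -XE setIidl.
- by apply: Pd PA; apply: subIsetr.
- by apply: Qd QB; apply: subIsetr.
Qed.

Lemma downward_closed_linimp P Q :
  downward_closed Q -> downward_closed (linimp P Q).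
Proof. by move=> Qd X Y YX PQX Z /PQX; apply: Qd; apply: setSU. Qed.

Lemma downward_closed_defined_by (L : logic) (f : formula V) :
  ~ L sNE -> ~ L sIndep -> ~ L sIncl -> ~ L sNeDisj -> in_logic L f ->
  downward_closed (defined_by f).
Proof.
move=> nNE nIndep nIncl nNeDisj.
elim: f => [i|i|||us j|us vs|k us vs|f IHf g IHg|f IHf g IHg|f _ g _
  |f IHf g IHg|f _ g IHg] //= fL; try by case: fL.
- exact: (@downward_closed_subsets [set s | s i = true]).
- exact: (@downward_closed_subsets [set s | s i = false]).
- by have := @downward_closed_subsets set0; rewrite subsets0.
- by move=> X Y YX Xdep s t /YX Xs /YX; apply: Xdep.
- by case: fL => _ /IHf fd /IHg gd; apply: (downward_closed_setI fd gd).
- by case: fL => _ /IHf fd /IHg gd; apply: (downward_closed_tensor fd gd).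
- by case: fL => _ /IHf fd /IHg gd; apply: (downward_closed_setU fd gd).
- by case: fL => _ _ /IHg gd; apply: (downward_closed_linimp gd).
Qed.

End DownwardClosed.

Lemma contains_empty_defined_by (V : Type) (L : logic) (f : formula V) :
  ~ L sNE -> ~ L sLinImp -> in_logic L f -> contains_empty (defined_by f).
Proof.
rewrite /contains_empty /defined_by /= => nNE nLinImp.
elim: f => //= [f IHf g IHg|f IHf g IHg|f _ g _|f IHf g _|f _ g _] [] //.
- by move=> _ /IHf f0 /IHg g0.
- by move=> _ /IHf f0 /IHg g0; exists set0, set0; rewrite setU0.
- by left.
- by move=> _ /IHf f0 _; left.
Qed.

Fixpoint rename (V W : Type) (r : V -> W) (f : formula V) : formula W :=
  match f with
  | Var i => Var (r i)
  | NegVar i => NegVar (r i)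
  | Bot => Bot
  | NE => NE
  | Dep us j => Dep (map r us) (r j)
  | Indep us vs => Indep (map r us) (map r vs)
  | Incl _ us vs => Incl (map_tuple r us) (map_tuple r vs)
  | And f g => And (rename r f) (rename r g)
  | Tensor f g => Tensor (rename r f) (rename r g)
  | NeDisj f g => NeDisj (rename r f) (rename r g)
  | BoolDisj f g => BoolDisj (rename r f) (rename r g)
  | LinImp f g => LinImp (rename r f) (rename r g)
  end.

Lemma in_logic_rename (V W : Type) (r : V -> W) (L : logic) (f : formula V) :
  in_logic L (rename r f) = in_logic L f.
Proof. by elim: f => //= f -> g ->. Qed.

Fixpoint vars (V : Type) (f : formula V) : seq V :=
  match f with
  | Var i | NegVar i => [:: i]
  | Bot | NE => [::]
  | Dep us j => j :: us
  | Indep us vs => us ++ vs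
  | Incl _ us vs => us ++ vs
  | And f g | Tensor f g | NeDisj f g | BoolDisj f g | LinImp f g =>
      vars f ++ vars g
  end.

Lemma renameK (V : eqType) (W : Type) (h : V -> W) (r : W -> V)
    (f : formula V) :
  {in vars f, cancel h r} -> rename r (rename h f) = f.
Proof.
have hrK us : {in us, cancel h r} -> map r (map h us) = us.
  by move=> usK; rewrite -map_comp map_id_in.
have in_catl (us vs : seq V) : {in us ++ vs, cancel h r} -> {in us, cancel h r}.
  by move=> K i ius; apply: K; rewrite mem_cat ius.
have in_catr (us vs : seq V) : {in us ++ vs, cancel h r} -> {in vs, cancel h r}.
  by move=> K i ivs; apply: K; rewrite mem_cat ivs orbT.
elim: f => [i|i|||us j|us vs|k us vs|f IHf g IHg|f IHf g IHg|f IHf g IHg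
  |f IHf g IHg|f IHf g IHg] //= K.
1,2: by rewrite K ?inE.
- by rewrite K ?mem_head// hrK// => i ius; apply: K; rewrite inE ius orbT.
- by rewrite (hrK _ (in_catl _ _ K)) (hrK _ (in_catr _ _ K)).
- by congr Incl; apply: val_inj;
    [apply: hrK (in_catl _ _ K)|apply: hrK (in_catr _ _ K)].
all: by rewrite (IHf (in_catl _ _ K)) (IHg (in_catr _ _ K)).
Qed.

Definition reindex (V W : Type) (r : V -> W) (s : valuation W) :
  valuation V := s \o r.

Definition reindex_team (V W : Type) (r : V -> W) (X : team W) : team V :=
  reindex r @` X.

Section Reindex.
Variables (V W : Type) (r : V -> W).
Implicit Types (P Q : team_property V) (X Y : team W).

Lemma preimage_reindex_subsets (A : team V) :
  reindex_team r @^-1` subsets A = subsets (reindex r @^-1` A).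
Proof. by apply/funext => X; apply/propext; apply: image_subP. Qed.

Lemma map_reindex (s : valuation W) (us : seq V) :
  map (reindex r s) us = map s (map r us).
Proof. exact: map_comp. Qed.

Lemma reindex_team_eq0 X : reindex_team r X = set0 <-> X = set0.
Proof.
by split=> [|->]; [exact: image_set0_set0|exact: image_set0].
Qed.

Lemma preimage_reindex_setD_set0 P :
  reindex_team r @^-1` (P `\ set0) = (reindex_team r @^-1` P) `\ set0.
Proof. by apply/seteqP; split=> X [PX X0]; split=> // /reindex_team_eq0. Qed.

Lemma preimage_reindex_tensor P Q :
  reindex_team r @^-1` tensor P Q =
  tensor (reindex_team r @^-1` P) (reindex_team r @^-1` Q).
Proof.
apply/seteqP; split=> X; last first.
  move=> [A [B [-> PA QB]]]; exists (reindex_team r A), (reindex_team r B).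
  by split=> //; apply: image_setU.
move=> [A [B [XAB PA QB]]].
have trace C : C `<=` reindex_team r X ->
    reindex_team r (X `&` reindex r @^-1` C) = C.
  by move=> CX; rewrite /reindex_team image_setI_preimage setIidr.
exists (X `&` reindex r @^-1` A), (X `&` reindex r @^-1` B); split.
- by rewrite -setIUr -preimage_setU -XAB setIidl//; apply: preimage_image.
- by rewrite /preimage /= trace// XAB; apply: subsetUl.
- by rewrite /preimage /= trace// XAB; apply: subsetUr.
Qed.

Lemma preimage_reindex_nedisj P Q :
  reindex_team r @^-1` nedisj P Q =
  nedisj (reindex_team r @^-1` P) (reindex_team r @^-1` Q).
Proof.
rewrite /nedisj preimage_setU preimage_reindex_tensor.
rewrite !preimage_reindex_setD_set0.
by congr (_ `|` _); apply/seteqP; split=> X /reindex_team_eq0.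
Qed.

Hypothesis r_inj : injective r.

Lemma range_reindex : range (reindex r) = setT.
Proof.
apply/seteqP; split=> // s _.
exists (fun j => `[< exists2 i, r i = j & s i >]) => //.
apply/funext => i; rewrite /reindex /=; apply/asboolP/idP => [[k /r_inj ->]//|].
by exists i.
Qed.

Lemma reindex_teamK (X : team V) : reindex_team r (reindex r @^-1` X) = X.
Proof. by apply: image_preimage; apply: range_reindex. Qed.

Lemma preimage_reindex_linimp P Q :
  reindex_team r @^-1` linimp P Q =
  linimp (reindex_team r @^-1` P) (reindex_team r @^-1` Q).
Proof.
apply/seteqP; split=> X PQX Y PY.
  by rewrite /preimage /= /reindex_team image_setU; apply: PQX.
rewrite -(reindex_teamK Y) -image_setU; apply: PQX.
by rewrite /preimage /= reindex_teamK.
Qed.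

Lemma defined_by_rename (f : formula V) :
  defined_by (rename r f) = reindex_team r @^-1` defined_by f.
Proof.
elim: f => [i|i|||us j|us vs|k us vs|f IHf g IHg|f IHf g IHg|f IHf g IHg
  |f IHf g IHg|f IHf g IHg].
- exact/esym/(preimage_reindex_subsets [set s | s i = true]).
- exact/esym/(preimage_reindex_subsets [set s | s i = false]).
- by apply/seteqP; split=> X /reindex_team_eq0.
- by apply/seteqP; split=> X X0 /reindex_team_eq0.
- apply/seteqP; split=> X dep.
    move=> _ _ [s Xs <-] [t Xt <-]; rewrite !map_reindex; exact: dep.
  move=> s t Xs Xt; rewrite -!map_reindex.
  by apply: dep; apply: imageP.
- apply/seteqP; split=> X ind.
    move=> _ _ [s Xs <-] [t Xt <-]; have [u [Xu us_s vs_t]] := ind s t Xs Xt.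
    by exists (reindex r u); rewrite !map_reindex; split=> //; apply: imageP.
  move=> s t Xs Xt.
  have [_ [[u Xu <-]]] := ind _ _ (imageP _ Xs) (imageP _ Xt).
  by rewrite !map_reindex; exists u.
- apply/seteqP; split=> X incl.
    move=> _ [s Xs <-]; have [t [Xt st]] := incl s Xs.
    by exists (reindex r t); rewrite !map_reindex; split=> //; apply: imageP.
  move=> s Xs; have [_ [[t Xt <-]]] := incl _ (imageP _ Xs).
  by rewrite !map_reindex; exists t.
- by rewrite !defined_by_And IHf IHg.
- by rewrite !defined_by_Tensor IHf IHg preimage_reindex_tensor.
- by rewrite !defined_by_NeDisj IHf IHg preimage_reindex_nedisj.
- by rewrite !defined_by_BoolDisj IHf IHg.
- by rewrite !defined_by_LinImp IHf IHg preimage_reindex_linimp.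
Qed.

End Reindex.

Section Restriction.
Variables (I : choiceType) (N : {fset I}).
Implicit Types P : team_property I.

Lemma prop_restr_rename (f : formula N) :
  prop_restr N (defined_by (rename (@fsval _ N) f)) = defined_by f.
Proof.
rewrite defined_by_rename; last exact: val_inj.
apply: image_preimage; apply/seteqP; split=> // X _.
by exists (reindex (@fsval _ N) @^-1` X) => //; apply/reindex_teamK/val_inj.
Qed.

Lemma contains_empty_restr P :
  contains_empty P -> contains_empty (prop_restr N P).
Proof. by move=> P0; exists set0 => //; apply: image_set0. Qed.

Lemma union_closed_restr P : union_closed P -> union_closed (prop_restr N P).
Proof.
move=> P_union F FP [Y0 FY0].
exists (\bigcup_(X in P `&` team_restr N @^-1` F) X).
  apply: P_union; first by move=> X [].
  by have [X PX XY0] := FP _ FY0; exists X; split; rewrite // /preimage /= XY0.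
rewrite [LHS]image_bigcup; apply/seteqP; split=> s [X].
  by move=> [_ FX] Xs; exists (team_restr N X).
move=> FX Xs; have [Y PY YX] := FP _ FX; rewrite -YX in FX Xs.
by exists Y.
Qed.

Lemma downward_closed_restr P :
  downward_closed P -> downward_closed (prop_restr N P).
Proof.
move=> Pd Z Y YZ [X PX XZ]; rewrite -{}XZ in YZ.
exists (X `&` val_restr N @^-1` Y); first by apply: Pd PX; apply: subIsetl.
by rewrite [LHS]image_setI_preimage setIidr.
Qed.

End Restriction.

Definition definable (V : Type) (L : logic) : set (team_property V) :=
  [set defined_by f | f in [set f : formula V | in_logic L f]].

Lemma definable_sub (V : Type) (L L' : logic) (P : team_property V) :
  L `<=` L' -> definable L P -> definable L' P.
Proof.
move=> LL' [f fL <-]; exists f => //; elim: f fL => /= *; try exact: LL'.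
all: by match goal with H : [/\ _, _ & _] |- _ => case: H => * end; split; auto.
Qed.

Section Definability.
Variables (V : Type) (L : logic).
Implicit Types (P Q : team_property V).

Lemma definable_set1_set0 : L sBot -> definable L [set (set0 : team V)].
Proof. by exists Bot. Qed.

Lemma definable_setI P Q :
  L sAnd -> definable L P -> definable L Q -> definable L (P `&` Q).
Proof. by move=> LAnd [f fL <-] [g gL <-]; exists (And f g). Qed.

Lemma definable_setU P Q :
  L sBoolDisj -> definable L P -> definable L Q -> definable L (P `|` Q).
Proof. by move=> LBoolDisj [f fL <-] [g gL <-]; exists (BoolDisj f g). Qed.

Lemma definable_tensor P Q :
  L sTensor -> definable L P -> definable L Q -> definable L (tensor P Q).
Proof. by move=> LTensor [f fL <-] [g gL <-]; exists (Tensor f g). Qed.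

Lemma definable_nedisj P Q :
  L sNeDisj -> definable L P -> definable L Q -> definable L (nedisj P Q).
Proof.
move=> LNeDisj [f fL <-] [g gL <-].
by exists (NeDisj f g) => //; apply: defined_by_NeDisj.
Qed.

Lemma definable_setD_set0 P :
  L sAnd -> L sNE -> definable L P -> definable L (P `\ set0).
Proof. by move=> LAnd LNE [f fL <-]; exists (And f NE). Qed.

Lemma definable_subsets_literal (s : valuation V) (i : V) :
  L sVar -> L sNegVar -> definable L (subsets [set t | t i = s i]).
Proof.
by move=> LVar LNegVar; case: (s i); [exists (Var i)|exists (NegVar i)].
Qed.

Lemma definable_setI_bigcap (T : Type) (A : set T)
    (F : T -> team_property V) P :
  L sAnd -> finite_set A -> definable L P -> (forall x, definable L (F x)) ->
  definable L (P `&` \bigcap_(x in A) F x).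
Proof.
move=> LAnd finA dP dF; elim/finite_set_ind: A / finA => [|x A dA].
  by rewrite bigcap_set0 setIT.
by rewrite bigcap_setU1 setICA; apply: definable_setI.
Qed.

Lemma definable_setU_bigcup (T : Type) (A : set T)
    (F : T -> team_property V) P :
  L sBoolDisj -> finite_set A -> definable L P ->
  (forall x, definable L (F x)) -> definable L (P `|` \bigcup_(x in A) F x).
Proof.
move=> LBoolDisj finA dP dF; elim/finite_set_ind: A / finA => [|x A dA].
  by rewrite bigcup_set0 setU0.
by rewrite bigcup_setU1 setUCA; apply: definable_setU.
Qed.

End Definability.

Section FiniteDefinability.
Variables (V : finType) (L : logic).
Hypotheses (LVar : L sVar) (LNegVar : L sNegVar).
Hypotheses (LBot : L sBot) (LAnd : L sAnd).
Implicit Types (s : valuation V) (X : team V) (P Q : team_property V).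

(* [P] starts the conjunction of literals, which is empty when [V] is. *)
Lemma definable_subsets1_within P s :
  definable L P -> subsets [set s] `<=` P -> definable L (subsets [set s]).
Proof.
move=> dP sP.
have -> : subsets [set s] =
    P `&` \bigcap_(i in [set: V]) subsets [set t | t i = s i].
  apply/seteqP; split=> X.
    by move=> Xs; split; [exact: sP|move=> i _ t /Xs ->].
  by move=> [_ Xs] t Xt; apply/funext => i; apply: (Xs i).
apply: definable_setI_bigcap => // i; exact: definable_subsets_literal.
Qed.

Lemma definable_subsets1 (i : V) s : definable L (subsets [set s]).
Proof.
apply: definable_subsets1_within (definable_subsets_literal s i LVar LNegVar) _.
by move=> X Xs t /Xs ->.
Qed.

Lemma definable_set1 X :
  L sNE -> L sTensor -> L sBoolDisj -> definable L [set X].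
Proof.
move=> LNE LTensor LBoolDisj.
have dT : definable L [set: team V].
  exists (BoolDisj Bot NE) => //; apply/seteqP; split=> // Y _; exact: EM.
elim/finite_set_ind: X / (finite_team X) => [|s X dX].
  exact: definable_set1_set0.
rewrite -tensor_set1; apply: definable_tensor => //.
have -> : [set [set s]] = subsets [set s] `\ set0.
  by rewrite subsets1 setU1K// => s0; apply: set1_neq0 (esym s0).
by apply: definable_setD_set0 => //; apply: definable_subsets1_within dT _.
Qed.

Lemma definable_set0_or1 (i : V) X : L sNeDisj -> definable L [set set0; X].
Proof.
move=> LNeDisj; elim/finite_set_ind: X / (finite_team X) => [|s X dX].
  by rewrite setUid; apply: definable_set1_set0.
have [->|X0] := pselect (X = set0).
  by rewrite setU0 -subsets1; apply: definable_subsets1.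
rewrite -(nedisj_set0_or1 (@set1_neq0 _ s) X0) -subsets1.
by apply: definable_nedisj => //; apply: definable_subsets1.
Qed.

Lemma definable_subsets (i : V) X : L sTensor -> definable L (subsets X).
Proof.
move=> LTensor; elim/finite_set_ind: X / (finite_team X) => [|s X dX].
  by rewrite subsets0; apply: definable_set1_set0.
rewrite -tensor_subsets; apply: definable_tensor => //.
exact: definable_subsets1.
Qed.

Lemma definable_union_closure (i : V) P :
  L sTensor -> L sNeDisj -> definable L (union_closure P).
Proof.
move=> LTensor LNeDisj.
elim/finite_set_ind: P / (finite_team_property P) => [|X P dP].
  by rewrite union_closure0; apply: definable_set1_set0.
rewrite union_closureU union_closure1; apply: definable_tensor => //.
exact: definable_set0_or1.
Qed.

End FiniteDefinability.

Ltac decide_symbol := cbv; intuition discriminate.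

Section ExpressiveCompleteness.
Variable V : finType.
Implicit Types P : team_property V.

Lemma definable_PTplus P : definable PTplus P.
Proof.
rewrite -[P]image_id -bigcup_imset1 -[X in definable _ X]set0U.
apply: definable_setU_bigcup; [decide_symbol|exact: finite_team_property| |].
- rewrite -(setDv [set set0]); apply: definable_setD_set0; try decide_symbol.
  by apply: definable_set1_set0; decide_symbol.
- by move=> X; apply: definable_set1; decide_symbol.
Qed.

Lemma definable_PT (i : V) P : contains_empty P -> definable PT P.
Proof.
move=> P0.
have -> : P = set0 |` \bigcup_(X in P) [set set0; X].
  apply/seteqP; split=> X; first by move=> PX; right; exists X => //; right.
  by move=> [->|[Y PY [->|->]]].
apply: definable_setU_bigcup; [decide_symbol|exact: finite_team_property| |].
- by apply: definable_set1_set0; decide_symbol.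
- by move=> X; apply: definable_set0_or1 i _ _; decide_symbol.
Qed.

Lemma definable_PU (i : V) P :
  union_closed P -> contains_empty P -> definable PU P.
Proof.
move=> P_union P0; rewrite -(union_closure_id P_union P0).
by apply: definable_union_closure i _ _ _; decide_symbol.
Qed.

Lemma definable_PUplus (i : V) P : union_closed P -> definable PUplus P.
Proof.
have PU_sub : PU `<=` PUplus by case; decide_symbol.
move=> P_union; have [P0|nP0] := pselect (P set0).
  by apply: definable_sub PU_sub _; apply: definable_PU.
rewrite -(setU1K nP0); apply: definable_setD_set0; try decide_symbol.
apply: definable_sub PU_sub _; apply: definable_PU => //; last by left.
exact: union_closed_setU_set0.
Qed.

Lemma definable_PD (i : V) P :
  downward_closed P -> contains_empty P -> definable PD P.
Proof.
move=> Pd P0.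
have -> : P = set0 |` \bigcup_(X in P) subsets X.
  apply/seteqP; split=> X; first by move=> PX; right; exists X.
  by move=> [->//|[Y PY XY]]; apply: Pd PY.
apply: definable_setU_bigcup; [decide_symbol|exact: finite_team_property| |].
- by apply: definable_set1_set0; decide_symbol.
- by move=> X; apply: definable_subsets i _ _; decide_symbol.
Qed.

Lemma definable_PDplus (i : V) P : downward_closed P -> definable PDplus P.
Proof.
move=> Pd; have [[X PX]|/nonemptyPn ->] := pselect (P !=set0).
  have PD_sub : PD `<=` PDplus by case; decide_symbol.
  apply: definable_sub PD_sub _; apply: definable_PD => //.
  by apply: Pd PX.
exists (LinImp (Var i) Bot); first by split; decide_symbol.
apply/seteqP; split=> // X /(_ [set fun=> true]) Xtrue.
have : (X `|` [set fun=> true]) (fun=> true) by right.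
by rewrite Xtrue// => s ->.
Qed.

End ExpressiveCompleteness.

Lemma characterizes_intro (I : choiceType) (L : logic)
    (C : forall V : Type, set (team_property V)) :
  (forall (V : Type) (f : formula V), in_logic L f -> C V (defined_by f)) ->
  (forall (N : {fset I}) P, C I P -> C N (prop_restr N P)) ->
  (forall (V : finType) (i : V) P, C V P -> definable L P) ->
  characterizes L (C I).
Proof.
move=> sound restr complete N N0; apply/seteqP; split.
  move=> _ [P /restr CP <-].
  have [N_eq0|[i iN]] := fset_0Vmem N; first by case: N0.
  exact: complete [` iN]%fset _ (CP N).
move=> _ [f fL <-]; exists (defined_by (rename (@fsval _ N) f)).
  by apply: sound; rewrite in_logic_rename.
exact: prop_restr_rename.
Qed.

Section Characterizations.
Variable I : choiceType.

Lemma PTplus_characterizes_all : characterizes PTplus [set: team_property I].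
Proof.
apply: (characterizes_intro (C := fun V => setT)) => // V _ P _.
exact: definable_PTplus.
Qed.

Lemma PTplus_sub_FPT : PTplus `<=` FPT.
Proof. by case; decide_symbol. Qed.

Lemma FPT_characterizes_all : characterizes FPT [set: team_property I].
Proof.
apply: (characterizes_intro (C := fun V => setT)) => // V _ P _.
exact: definable_sub PTplus_sub_FPT (definable_PTplus P).
Qed.

Lemma PT_characterizes_contains_empty :
  characterizes PT [set P : team_property I | contains_empty P].
Proof.
apply: (characterizes_intro (C := @contains_empty)).
- by move=> V f; apply: contains_empty_defined_by; decide_symbol.
- exact: contains_empty_restr.
- exact: definable_PT.
Qed.

Lemma PU_characterizes_union_closed_contains_empty :
  characterizes PU
    [set P : team_property I | union_closed P /\ contains_empty P].
Proof.
apply: (characterizes_intro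
  (C := fun V => [set P | union_closed P /\ contains_empty P])).
- move=> V f fL; split.
    by apply: union_closed_defined_by fL; decide_symbol.
  by apply: contains_empty_defined_by fL; decide_symbol.
- move=> N P [P_union P0].
  by split; [apply: union_closed_restr|apply: contains_empty_restr].
- by move=> V i P [P_union P0]; apply: definable_PU.
Qed.

Lemma PUplus_characterizes_union_closed :
  characterizes PUplus [set P : team_property I | union_closed P].
Proof.
apply: (characterizes_intro (C := @union_closed)).
- by move=> V f; apply: union_closed_defined_by; decide_symbol.
- exact: union_closed_restr.
- exact: definable_PUplus.
Qed.

Lemma PD_characterizes_downward_closed_contains_empty :
  characterizes PD
    [set P : team_property I | downward_closed P /\ contains_empty P].
Proof.
apply: (characterizes_intro
  (C := fun V => [set P | downward_closed P /\ contains_empty P])).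
- move=> V f fL; split.
    by apply: downward_closed_defined_by fL; decide_symbol.
  by apply: contains_empty_defined_by fL; decide_symbol.
- move=> N P [Pd P0].
  by split; [apply: downward_closed_restr|apply: contains_empty_restr].
- by move=> V i P [Pd P0]; apply: definable_PD.
Qed.

Lemma PDplus_characterizes_downward_closed :
  characterizes PDplus [set P : team_property I | downward_closed P].
Proof.
apply: (characterizes_intro (C := @downward_closed)).
- by move=> V f; apply: downward_closed_defined_by; decide_symbol.
- exact: downward_closed_restr.
- exact: definable_PDplus.
Qed.

Lemma exists_fset_retraction (us : seq I) :
  exists (N : {fset I}) (h : I -> N), {in us, cancel h (@fsval _ N)}.
Proof.
have [[i0 _]|I0] := pselect (exists i : I, True); last first.
  by exists fset0, (fun i => False_rect _ (I0 (ex_intro _ i Logic.I))).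
pose N : {fset I} := [fset i in i0 :: us]%fset.
have i0N : i0 \in N by rewrite !inE eqxx.
exists N, (insubd [` i0N]%fset) => i ius.
by rewrite insubdK// !inE ius orbT.
Qed.

Lemma equivalent_defined_by (f g : formula I) :
  defined_by f = defined_by g -> equivalent f g.
Proof. by move=> fg X; rewrite -[sat X f]/(defined_by f X) fg. Qed.

Lemma exists_PTplus_equivalent (f : formula I) :
  exists g, in_logic PTplus g /\ equivalent f g.
Proof.
have [N [h hK]] := exists_fset_retraction (vars f).
have [g gL gE] := definable_PTplus (defined_by (rename h f)).
exists (rename (@fsval _ N) g); split; first by rewrite in_logic_rename.
apply: equivalent_defined_by; rewrite -[in LHS](renameK hK).
by rewrite !(defined_by_rename (@val_inj _ _ N)) gE.
Qed.

Lemma PTplus_same_expressive_power_FPT : same_expressive_power I PTplus FPT.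
Proof.
split=> [f fPT|f _]; last exact: exists_PTplus_equivalent.
have [g gFPT gE] : definable FPT (defined_by f).
  by apply: definable_sub PTplus_sub_FPT _; exists f.
by exists g; split=> //; apply: equivalent_defined_by.
Qed.

End Characterizations.

Theorem theorem3p4 (I : choiceType) :
  (characterizes PTplus [set: team_property I] /\
   characterizes FPT [set: team_property I] /\
   same_expressive_power I PTplus FPT) /\
  characterizes PT [set P : team_property I | contains_empty P] /\
  characterizes PU
    [set P : team_property I | union_closed P /\ contains_empty P] /\
  characterizes PUplus [set P : team_property I | union_closed P] /\
  characterizes PD
    [set P : team_property I | downward_closed P /\ contains_empty P] /\
  characterizes PDplus [set P : team_property I | downward_closed P].
Proof.
split; first split; last split.
- exact: PTplus_characterizes_all.
- split; first exact: FPT_characterizes_all.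
  exact: PTplus_same_expressive_power_FPT.
- exact: PT_characterizes_contains_empty.
split; first exact: PU_characterizes_union_closed_contains_empty.
split; first exact: PUplus_characterizes_union_closed.
split; first exact: PD_characterizes_downward_closed_contains_empty.
exact: PDplus_characterizes_downward_closed.
Qed.
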